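(* Let $W\in\mathbb{R}^{d_L\times d_0}$. Each stratum $S_{\underline{r}}$ in the rank stratification of the fiber $\mu^{-1}(W)$ is a manifold of class $C^\infty$ (embedded in the weight space $\mathbb{R}^{d_\theta}$).
   Context: Fix integers $L\ge1$ and $d_0,\ldots,d_L\ge1$. The weight space is $\mathbb{R}^{d_\theta}=\mathbb{R}^{d_L\times d_{L-1}}\times\cdots\times\mathbb{R}^{d_1\times d_0}$, $d_\theta=\sum_{j=1}^Ld_jd_{j-1}$; a weight vector is $\theta=(W_L,\ldots,W_1)$ with $W_j\in\mathbb{R}^{d_j\times d_{j-1}}$. The matrix multiplication map is $\mu(\theta)=W_LW_{L-1}\cdots W_1$ and $\mu^{-1}(W)=\{\theta\in\mathbb{R}^{d_\theta}:\mu(\theta)=W\}$. For $L\ge k\ge i\ge0$, $W_{k\sim i}=W_kW_{k-1}\cdots W_{i+1}$, with $W_{k\sim k}=I_{d_k\times d_k}$. The rank list of $\theta$ is the family $\langle\operatorname{rk}W_{k\sim i}\rangle_{L\ge k\ge i\ge0}$. For a rank list $\underline{r}$, the stratum is $S_{\underline{r}}=\{\theta\in\mu^{-1}(W):\text{the rank list of }\theta\text{ is }\underline{r}\}$; the rank stratification of $\mu^{-1}(W)$ is the set of all $S_{\underline{r}}$ with $\underline{r}$ the rank list of some weight vector in $\mu^{-1}(W)$. Manifolds are without boundary and are not required to be closed subsets, connected, or bounded. *)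

(* Defs.v *)
From HB Require Import structures.
From mathcomp Require Import all_boot all_order all_algebra.
From mathcomp Require Import all_classical all_reals all_analysis.

Set Implicit Arguments.
Unset Strict Implicit.
Unset Printing Implicit Defensive.

Import Order.TTheory GRing.Theory Num.Theory.
Import numFieldNormedType.Exports.

Local Open Scope classical_set_scope.
Local Open Scope ring_scope.

(** * Smooth maps and embedded submanifolds of R^n *)

Section Smooth.
Variable R : realType.

(* The partial derivative along the j-th coordinate is the directional
   derivative along the basis vector [delta_mx 0 j]. *)
Fixpoint Ck_on (k n m : nat) (U : set 'rV[R]_n) (f : 'rV[R]_n -> 'rV[R]_m)
    : Prop :=
  (forall x, U x -> {for x, continuous f}) /\
  match k with
  | 0 => True
  | k'.+1 => forall j : 'I_n,
      (forall x, U x -> derivable f x (delta_mx 0 j)) /\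
      Ck_on k' U (fun x => 'D_(delta_mx 0 j) f x)
  end.

(* Only used for open [U]. *)
Definition smooth_on (n m : nat) (U : set 'rV[R]_n)
  (f : 'rV[R]_n -> 'rV[R]_m) := forall k, Ck_on k U f.

Definition smooth_diffeo (n : nat) (U V : set 'rV[R]_n)
    (f : 'rV[R]_n -> 'rV[R]_n) : Prop :=
  [/\ open U, open V, f @` U = V, smooth_on U f &
      exists2 g : 'rV[R]_n -> 'rV[R]_n,
        smooth_on V g & forall x, U x -> g (f x) = x].

(* R^k x {0} in R^n, for k <= n. *)
Definition coord_subspace (n k : nat) : set 'rV[R]_n :=
  [set y | forall j : 'I_n, (k <= j)%N -> y 0 j = 0].

(* Slice charts; the set carries the subspace topology, and all its points
   have the same dimension k.  It need not be closed, connected or bounded. *)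
Definition embedded_submanifold (n k : nat) (S : set 'rV[R]_n) : Prop :=
  (k <= n)%N /\
  forall p, S p -> exists (U V : set 'rV[R]_n) (f : 'rV[R]_n -> 'rV[R]_n),
    [/\ U p, smooth_diffeo U V f &
        f @` (S `&` U) = coord_subspace k `&` V].

Definition smooth_manifold (n : nat) (S : set 'rV[R]_n) : Prop :=
  exists k, embedded_submanifold k S.

End Smooth.

(** * Deep linear networks *)

(* A_{k-1} ... A_0, for matrices A_j : R^{e_j} -> R^{e_{j+1}}. *)
Fixpoint chain_prod (R : realType) (e : nat -> nat)
    (A : forall j, 'M[R]_(e j.+1, e j)) (k : nat) : 'M[R]_(e k, e 0%N) :=
  match k with
  | 0 => 1%:M
  | k'.+1 => A k' *m chain_prod A k'
  end.

Section Fibers.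
Variables (R : realType) (L : nat) (d : nat -> nat).

(* Only d 0, ..., d L matter. *)
Definition dtheta : nat := (\sum_(j < L) d j.+1 * d j)%N.

(* R^{d_theta} as row vectors: the j-th block, of length d_{j+1} d_j, lists the
   entries of W_{j+1}. *)
Definition weight_space := 'rV[R]_dtheta.

(* [layer theta j] is W_{j+1}, for j < L; the value 0 for j >= L is never
   used. *)
Definition layer (theta : weight_space) (j : nat) : 'M[R]_(d j.+1, d j) :=
  if pselect (j < L)%N is left j_lt_L
  then vec_mx (submxrow theta (Ordinal j_lt_L)) else 0.

Definition mu (theta : weight_space) : 'M[R]_(d L, d 0%N) :=
  chain_prod (layer theta) L.

Definition fiber (W : 'M[R]_(d L, d 0%N)) : set weight_space :=
  [set theta | mu theta = W].

(* W_{k~i} = W_k ... W_{i+1}, for i <= k <= L: a product of k - i layers,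
   starting with W_{i+1} = layer theta i on the right.  The number of rows is
   d_k, in the form d (k - i + i). *)
Definition subproduct (theta : weight_space) (k i : nat)
    : 'M[R]_(d (k - i + i)%N, d i) :=
  chain_prod (e := fun j => d (j + i)%N) (fun j => layer theta (j + i)%N) (k - i)%N.

(* r k i stands for r_{k~i}; only the values with i <= k <= L matter. *)
Definition has_rank_list (theta : weight_space) (r : nat -> nat -> nat) :=
  forall k i, (i <= k <= L)%N -> \rank (subproduct theta k i) = r k i.

Definition stratum (W : 'M[R]_(d L, d 0%N)) (r : nat -> nat -> nat)
    : set weight_space :=
  [set theta | fiber W theta /\ has_rank_list theta r].

Definition rank_stratification (W : 'M[R]_(d L, d 0%N))
    : set (set weight_space) :=
  [set S | exists2 r, S = stratum W r &
           exists2 theta, fiber W theta & has_rank_list theta r].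

End Fibers.

(* Main.v *)
From HB Require Import structures.
Require Import Defs.
From mathcomp Require Import all_boot all_order all_algebra.
From mathcomp Require Import all_classical all_reals all_analysis.

Set Implicit Arguments.
Unset Strict Implicit.
Unset Printing Implicit Defensive.

Import Order.TTheory GRing.Theory Num.Theory.
Import numFieldNormedType.Exports.

Local Open Scope classical_set_scope.
Local Open Scope ring_scope.

(** Two chains of matrices with the same rank list are isomorphic: an
  isomorphism at the last level that matches the flags im W_{n~i} lifts level
  by level, by extending linear maps along the flags.  Hence, for theta and
  theta0 in the stratum S, the rank of the linear map
  [T theta : F |-> (F_{j+1} theta0_j - theta_j F_j)_j], on the space of the
  families F = (F_0, ..., F_L) with F_L W = W F_0, depends neither on theta nor
  on theta0.

  Let N be a generalized inverse of T theta0.  For theta near theta0, exactly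
  one F in 1 + im N satisfies T theta F \in ker N.  The slice chart at theta0
  maps theta to the pair (F - 1, T theta F).  This map and its inverse
  [theta_j = (F_{j+1} theta0_j - (T theta F)_j) F_j^-1] are both rational, so
  no inverse function theorem is needed.  If theta lies in S, then constancy
  of the rank gives ker (N T theta) = ker (T theta), so T theta F = 0;
  conversely, if T theta F = 0, then F is an isomorphism from theta0 to theta
  with F_L W = W F_0, so theta lies in S. *)

(** * Isomorphisms of chains of matrices *)

Section Lifting.
Variables (F : fieldType) (n p : nat).
Implicit Types A X g : 'M[F]_n.

Lemma exists_row_not_sub m (X : 'M[F]_(m, n)) A :
  ~~ (X <= A)%MS -> exists2 x : 'rV_n, (x <= X)%MS & ~~ (x <= A)%MS.
Proof. by case/row_subPn => i xA; exists (row i X); rewrite ?row_sub. Qed.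

(** The columns of [cokermx A] cut out the row space of [A], so one of them is nonzero on [x];
    rescaling it gives [c]. *)
Lemma exists_separating_functional A (x : 'rV[F]_n) :
  ~~ (x <= A)%MS -> exists2 c : 'cV_n, A *m c = 0 & x *m c = 1%:M.
Proof.
rewrite submxE; move: (cokermx A) (mulmx_coker A) => C AC /rV0Pn[j xj].
exists (((x *m C) 0 j)^-1 *: (C *m delta_mx j 0)).
  by rewrite -scalemxAr mulmxA AC mul0mx scaler0.
rewrite -scalemxAr mulmxA -colE; apply/matrixP => a b.
by rewrite !ord1 mxE [col _ _ _ _]mxE mulVf // mxE.
Qed.

Lemma mxrank_adds_row A (x : 'rV[F]_n) :
  ~~ (x <= A)%MS -> \rank (A + x)%MS = (\rank A).+1.
Proof.
move=> xA; apply/eqP; rewrite eqn_leq; apply/andP; split.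
  rewrite -[(\rank A).+1]addn1 (leq_trans (mxrank_adds_leqif A x)) //.
  by rewrite leq_add2l rank_leq_row.
rewrite ltn_neqAle (mxrank_leqif_eq (addsmxSl A x)) mxrankS ?addsmxSl // andbT.
by apply: contra xA => /andP[_ h]; apply: submx_trans h; apply: addsmxSr.
Qed.

Variables W W' : 'M[F]_(n, p).

(** Supplies the pair of vectors by which [extend_lift] enlarges [A] and [A']. If [X :&: kermx W] is
    not inside [A], both vectors can be taken in the kernels. Otherwise any [x] in [X] outside [A]
    works, with any preimage [x'] in [X'] of [x *m W]: were [x'] in [A'], then [x] would differ from
    a vector of [A] by an element of [X :&: kermx W], hence lie in [A]. *)
Lemma exists_matching_row A A' X X' g :
  (A <= X)%MS -> (A' <= X')%MS -> \rank A = \rank A' -> \rank X = \rank X' ->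
  (\rank A < \rank X)%N ->
  (A *m g :=: A')%MS -> A *m g *m W' = A *m W -> (X *m W :=: X' *m W')%MS ->
  exists x x' : 'rV_n, [/\ (x <= X)%MS, ~~ (x <= A)%MS, (x' <= X')%MS,
    ~~ (x' <= A')%MS & x *m W = x' *m W'].
Proof.
move=> AX AX' rA rX lt_r eA gW eX.
have eAW : (A *m W :=: A' *m W')%MS.
  by rewrite -gW; apply: eqmxMr.
have [KA|/exists_row_not_sub[x xK xA]] := boolP (X :&: kermx W <= A)%MS.
  have : ~~ (X <= A)%MS by apply: contraTN lt_r => /mxrankS; rewrite -leqNgt.
  case/exists_row_not_sub => x xX xA.
  have : (x *m W <= X' *m W')%MS by rewrite -eX submxMr.
  case/submxP => y xW; exists x, (y *m X').
  rewrite xX xA submxMl xW mulmxA; split=> //.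
  apply: contra xA => yA'.
  have : (x *m W <= A *m W)%MS by rewrite eAW xW mulmxA; apply: submxMr.
  case/submxP => z xzW.
  rewrite -[x](subrK (z *m A)) addmx_sub ?submxMl //.
  apply: submx_trans KA; rewrite sub_capmx; apply/andP; split.
    by rewrite addmx_sub // -mulNmx (submx_trans _ AX) ?submxMl.
  by apply/sub_kermxP; rewrite mulmxBl xzW mulmxA subrr.
move: xK; rewrite sub_capmx => /andP[xX /sub_kermxP xW].
(* By rank-nullity the kernels on [X] and [X'] have equal rank, and likewise those on [A] and [A'].
   If the kernel on [X'] lay in [A'], all four ranks would agree and the kernel on [X] would lie in
   [A]. *)
have : ~~ (X' :&: kermx W' <= A')%MS.
  apply: contra xA => KA'.
  have eK' : \rank (X' :&: kermx W')%MS = \rank (A' :&: kermx W')%MS.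
    apply/eqP; rewrite eqn_leq; apply/andP; split; apply: mxrankS.
      by rewrite sub_capmx KA' capmxSr.
    by rewrite capmxS.
  have eK : \rank (X :&: kermx W)%MS = \rank (A :&: kermx W)%MS.
    have := mxrank_mul_ker X W; rewrite eX rX -(mxrank_mul_ker X' W') => /addnI ->.
    have := mxrank_mul_ker A W; rewrite eAW rA -(mxrank_mul_ker A' W') => /addnI ->.
    by [].
  have sK : (A :&: kermx W <= X :&: kermx W)%MS by rewrite capmxS.
  have := mxrank_leqif_sup sK => -[_]; rewrite eK eqxx => /esym sXA.
  apply: submx_trans (capmxSl A (kermx W)); apply: submx_trans sXA.
  by rewrite sub_capmx xX; apply/sub_kermxP.
case/exists_row_not_sub => x'; rewrite sub_capmx => /andP[xX' /sub_kermxP xW'] xA'.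
by exists x, x'; split; rewrite ?xW ?xW'.
Qed.

(** Induction on the codimension of [A] in [X], adding one matching pair of vectors at a time. *)
Lemma extend_lift A A' X X' g :
  (A <= X)%MS -> (A' <= X')%MS -> \rank A = \rank A' -> \rank X = \rank X' ->
  (A *m g :=: A')%MS -> A *m g *m W' = A *m W -> (X *m W :=: X' *m W')%MS ->
  exists g1 : 'M[F]_n, [/\ (X *m g1 :=: X')%MS, X *m g1 *m W' = X *m W &
                        A *m g1 = A *m g].
Proof.
have [k] := ubnP (\rank X - \rank A)%N.
elim: k A A' g => // k IHk A A' g ltk AX AX' rA rX eA gW eX.
have [rXA|lt_r] := leqP (\rank X) (\rank A).
  have XA : (X <= A)%MS by rewrite -(geq_leqif (mxrank_leqif_sup AX)).
  have XA' : (X' <= A')%MS by rewrite -(geq_leqif (mxrank_leqif_sup AX')) -rA -rX.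
  exists g; split => //; last by case/submxP: XA => z ->; rewrite -!(mulmxA z) gW.
  apply/eqmxP/andP; split.
    by rewrite (submx_trans (submxMr g XA)) // eA.
  by rewrite (submx_trans XA') // -eA submxMr.
have [x [x' [xX xA xX' xA' xW]]] := exists_matching_row AX AX' rA rX lt_r eA gW eX.
have [c Ac xc] := exists_separating_functional xA.
(* This rank-one correction vanishes on [A], where [c] is zero, and moves the image of [x] to
   [x']. *)
pose g' := g + c *m (x' - x *m g).
have Ag' : A *m g' = A *m g by rewrite mulmxDr mulmxA Ac mul0mx addr0.
have xg' : x *m g' = x' by rewrite mulmxDr mulmxA xc mul1mx addrC subrK.
have eA1 : ((A + x)%MS *m g' :=: (A' + x')%MS)%MS.
  by apply: (eqmx_trans (addsmxMr _ _ _)); rewrite Ag' xg'; apply: adds_eqmx.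
have [|||||] := IHk (A + x)%MS (A' + x')%MS g' _ _ _ _ rX eA1 _ eX.
- by rewrite mxrank_adds_row // subnS prednK ?subn_gt0 // -ltnS.
- by rewrite addsmx_sub AX.
- by rewrite addsmx_sub AX'.
- by rewrite !mxrank_adds_row // rA.
- have : (A + x <= col_mx A x)%MS by rewrite addsmxE.
  case/submxP => z ->; rewrite -!mulmxA !(mulmxA _ g') !mul_col_mx.
  by rewrite Ag' xg' gW xW.
move=> g1 [e1 e2 e3]; exists g1; split => //; rewrite -Ag'.
by case/submxP: (addsmxSl A x) => z zE; rewrite zE -!mulmxA e3.
Qed.

End Lifting.

(** A lift on [X N] is extended to [X N.+1] without changing it on [X N], so the smaller members of
    the flag stay matched. The induction starts by extending from the zero subspace. *)
Lemma lift_flag (F : fieldType) (n p N : nat) (W W' : 'M[F]_(n, p))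
    (X X' : nat -> 'M[F]_n) :
  (forall i, (X i <= X i.+1)%MS) -> (forall i, (X' i <= X' i.+1)%MS) ->
  (forall i, (i <= N)%N -> \rank (X i) = \rank (X' i)) ->
  (forall i, (i <= N)%N -> (X i *m W :=: X' i *m W')%MS) ->
  exists2 g : 'M[F]_n, (forall i, (i <= N)%N -> (X i *m g :=: X' i)%MS) &
    X N *m g *m W' = X N *m W.
Proof.
move=> XS XS' rX eX; have XN i m : (i <= m)%N -> (X i <= X m)%MS.
  by elim: m => [|m IHm]; rewrite leq_eqVlt => /predU1P[->//|] // /IHm/submx_trans->.
elim: N rX eX => [|N IHN] rX eX.
  have [|||||||g [e1 e2 _]] := @extend_lift _ _ _ W W' 0 0 (X 0%N) (X' 0%N) 0;
    rewrite ?sub0mx ?mul0mx ?rX //; first exact: eX.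
  by exists g => // i; rewrite leqn0 => /eqP->.
have [i iN|i iN|g gX gW] := IHN; [exact/rX/leqW|exact/eX/leqW|].
have [|||||||g1 [e1 e2 e3]] := @extend_lift _ _ _ W W' (X N) (X' N)
    (X N.+1) (X' N.+1) g;
  rewrite ?rX // ?leqnSn //; first exact: gX.
  exact: eX.
exists g1 => // i; rewrite leq_eqVlt => /predU1P[->//|]; rewrite ltnS => iN.
have -> : X i *m g1 = X i *m g.
  by case/submxP: (XN _ _ iN) => z ->; rewrite -!mulmxA e3.
exact: gX.
Qed.

(** * Chains with equal rank lists are isomorphic *)

Section ChainIso.
Variables (R : realType) (d : nat -> nat).
Implicit Types A : forall j, 'M[R]_(d j.+1, d j).

(* The row space of [image_flag A n i] is the image of A_{n-1} ... A_i, transposed;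
   it is everything for i >= n. *)
Fixpoint image_flag A (n i : nat) : 'M[R]_(d n) :=
  match n with
  | 0 => 1%:M
  | n'.+1 => if (n' < i)%N then 1%:M else <<image_flag A n' i *m (A n')^T>>%MS
  end.

Lemma image_flag_ge A n i : (n <= i)%N -> image_flag A n i = 1%:M.
Proof. by case: n => //= n ->. Qed.

Lemma image_flag_chain A m i :
  (image_flag A (m + i) i
     :=: (chain_prod (e := fun j => d (j + i)%N) (fun j => A (j + i)%N) m)^T)%MS.
Proof.
elim: m => [|m IHm]; first by rewrite /= trmx1 image_flag_ge.
rewrite /= ltnNge leq_addl /= trmx_mul.
by apply: eqmx_trans (genmxE _) _; apply: eqmxMr.
Qed.

Lemma image_flagS A n i : (image_flag A n i <= image_flag A n i.+1)%MS.
Proof.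
elim: n => //= n IHn; case: ltnP => ni; first by rewrite ltnS ltnW.
case: ltnP => _; first exact: submx1.
by rewrite !genmxE submxMr.
Qed.

Variables A A' : forall j, 'M[R]_(d j.+1, d j).

Lemma image_flag_unit n (h : 'M[R]_(d n)) :
  (image_flag A n n *m h :=: image_flag A' n n)%MS -> h \in unitmx.
Proof.
rewrite !image_flag_ge // mul1mx => eh.
by rewrite -row_full_unit /row_full eh mxrank1.
Qed.

(** The isomorphism is built from the last level downwards; matching all the image flags is the
    invariant that lets it descend one more level. *)
Lemma chain_iso_extend n (h : 'M[R]_(d n)) :
  (forall k i, (k <= n)%N -> \rank (image_flag A k i) = \rank (image_flag A' k i)) ->
  h \in unitmx ->
  (forall i, (i <= n)%N -> (image_flag A n i *m h :=: image_flag A' n i)%MS) ->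
  exists g : forall j, 'M[R]_(d j),
    [/\ forall j, (j <= n)%N -> g j \in unitmx,
        forall j, (j < n)%N -> (A j)^T *m g j.+1 = g j *m (A' j)^T & g n = h].
Proof.
elim: n h => [|n IHn] h rA uh eh.
  exists (eqtype.dfwith (fun j => 1%:M : 'M[R]_(d j)) h).
  split=> //; last exact: dfwith_in.
  by move=> j; rewrite leqn0 => /eqP->; rewrite dfwith_in.
(* With this choice of maps the lifting equation is the commutation with [A n] and [A' n]. It is
   obtained on the last member of the flag, which is the whole space, so it holds everywhere and
   [h'] is invertible. *)
have [||i ni|i ni|h' eh' hW] := @lift_flag _ _ _ n ((A n)^T *m h) (A' n)^T
   (image_flag A n) (image_flag A' n); try exact: image_flagS.
- by rewrite rA.
- have := eh i (leqW ni); rewrite /= ltnNge ni /= => e.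
  apply: eqmx_trans (eqmx_trans e (genmxE _)); rewrite mulmxA.
  by apply: eqmxMr; apply: eqmx_sym; apply: genmxE.
have uh' : h' \in unitmx by apply/image_flag_unit/eh'.
have [k i kn|g [ug gA gn]] := IHn h' _ uh' eh'; first by rewrite rA // leqW.
exists (eqtype.dfwith g h); split; last exact: dfwith_in.
  move=> j; rewrite leq_eqVlt => /predU1P[->|jn]; first by rewrite dfwith_in.
  by rewrite dfwith_out ?ug // gtn_eqF.
move=> j; rewrite ltnS leq_eqVlt => /predU1P[->|jn].
  rewrite dfwith_in dfwith_out ?gtn_eqF // gn.
  by move: hW; rewrite image_flag_ge // !mul1mx.
by rewrite !dfwith_out ?gA // gtn_eqF // ltnS ltnW.
Qed.

Lemma chain_iso n :
  (forall k i, (i <= k <= n)%N ->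
    \rank (chain_prod (e := fun j => d (j + i)%N) (fun j => A (j + i)%N) (k - i)) =
    \rank (chain_prod (e := fun j => d (j + i)%N) (fun j => A' (j + i)%N) (k - i))) ->
  exists2 g : forall j, 'M[R]_(d j),
    (forall j, (j <= n)%N -> g j \in unitmx) &
    forall j, (j < n)%N -> g j.+1 *m A j = A' j *m g j.
Proof.
move=> rA.
have rF k i : (k <= n)%N -> \rank (image_flag A k i) = \rank (image_flag A' k i).
  move=> kn; have [ki|/ltnW ik] := leqP k i; first by rewrite !image_flag_ge.
  have := rA k i; rewrite ik kn => /(_ isT).
  move: ik kn => /subnK <-; rewrite addnK => _ e.
  by rewrite !image_flag_chain !mxrank_tr.
(* At the last level there is nothing to commute with: zero maps into the zero space leave only the
   matching of the flags. *)
have [|||i ni|h eh _] := @lift_flag _ _ 0 n 0 0 (image_flag A n) (image_flag A' n);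
  try exact: image_flagS.
- by move=> i _; rewrite rF.
- by rewrite !mulmx0.
have uh : h \in unitmx by apply/image_flag_unit/eh.
have [g [ug gA _]] := chain_iso_extend rF uh eh.
exists (fun j => (g j)^T) => [j /ug|j jn]; first by rewrite unitmx_tr.
by apply: trmx_inj; rewrite !trmx_mul !trmxK gA.
Qed.
End ChainIso.

(** * Smoothness of rational maps *)

Section Rational.
Variables (R : realType) (n : nat).
Implicit Types (U : set 'rV[R]_n) (phi psi : 'rV[R]_n -> R).

(** [rational_ext] makes only the values on [U] matter, so conventional values of inverses outside
    [U] are harmless. *)
Inductive rational_on U : ('rV[R]_n -> R) -> Prop :=
| rational_cst (c : R) : rational_on U (fun=> c)
| rational_coord (j : 'I_n) : rational_on U (fun x => x 0 j)
| rational_add phi psi : rational_on U phi -> rational_on U psi ->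
    rational_on U (fun x => phi x + psi x)
| rational_mul phi psi : rational_on U phi -> rational_on U psi ->
    rational_on U (fun x => phi x * psi x)
| rational_inv phi : (forall x, U x -> phi x != 0) -> rational_on U phi ->
    rational_on U (fun x => (phi x)^-1)
| rational_ext phi psi : (forall x, U x -> phi x = psi x) ->
    rational_on U phi -> rational_on U psi.

Lemma rational_sum U (I : Type) (r : seq I) (P : pred I) (F : I -> 'rV[R]_n -> R) :
  (forall i, rational_on U (F i)) ->
  rational_on U (fun x => \sum_(i <- r | P i) F i x).
Proof.
move=> FU; elim: r => [|i r IHr].
  by apply: rational_ext (rational_cst U 0) => x _; rewrite big_nil.
apply: (@rational_ext _ (fun x =>
  (if P i then F i x else 0) + \sum_(i <- r | P i) F i x)).
  by move=> x _; rewrite big_cons; case: (P i); rewrite ?add0r.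
by apply: rational_add => //; case: (P i) => //; apply: rational_cst.
Qed.

Lemma rational_prod U (I : Type) (r : seq I) (P : pred I) (F : I -> 'rV[R]_n -> R) :
  (forall i, rational_on U (F i)) ->
  rational_on U (fun x => \prod_(i <- r | P i) F i x).
Proof.
move=> FU; elim: r => [|i r IHr].
  by apply: rational_ext (rational_cst U 1) => x _; rewrite big_nil.
apply: (@rational_ext _ (fun x =>
  (if P i then F i x else 1) * \prod_(i <- r | P i) F i x)).
  by move=> x _; rewrite big_cons; case: (P i); rewrite ?mul1r.
by apply: rational_mul => //; case: (P i) => //; apply: rational_cst.
Qed.

(** The class is stable under partial derivatives by the sum, product and inverse rules; openness of
    [U] is what lets [rational_ext] preserve derivatives. *)
Lemma rational_is_derive U phi (j : 'I_n) : open U -> rational_on U phi ->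
  exists2 psi, rational_on U psi &
    forall x, U x -> is_derive x (delta_mx 0 j : 'rV[R]_n)
                            (phi : 'rV[R]_n -> R^o) (psi x).
Proof.
move=> oU; elim=> [c|i|f g _ [f' rf' df] _ [g' rg' dg]
                  |f g rf [f' rf' df] rg [g' rg' dg]
                  |f f0 rf [f' rf' df]|f g fg _ [f' rf' df]].
- exists (fun=> 0); first exact: rational_cst.
  by move=> x _; apply: is_derive_cst.
- exists (fun=> (j == i)%:R); first exact: rational_cst.
  move=> x _; have dx : derivable (id : 'rV[R]_n -> 'rV[R]_n) x (delta_mx 0 j) by [].
  apply: DeriveDef; first exact: (derivable_mxP _ _ _).1 dx 0 i.
  have := derive_mx dx; rewrite derive_id => /matrixP/(_ 0 i).
  by rewrite !mxE /= eq_sym => <-.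
- exists (fun x => f' x + g' x); first exact: rational_add.
  by move=> x Ux; apply: is_deriveD; [apply: df|apply: dg].
- exists (fun x => f x * g' x + g x * f' x).
    by apply: rational_add; apply: rational_mul.
  by move=> x Ux; apply: is_deriveM; [apply: df|apply: dg].
- exists (fun x => (- 1) * ((f x)^-1 * (f x)^-1 * f' x)).
    apply: rational_mul; first exact: rational_cst.
    by apply: rational_mul => //; apply: rational_mul; apply: rational_inv.
  move=> x Ux; have [dfx <-] := df x Ux.
  apply: DeriveDef; first by apply: derivableV => //; apply: f0.
  rewrite deriveV ?f0 // /GRing.scale /= mulN1r -mulNr expr2 invfM.
  by rewrite mulNr.
- exists f' => // x Ux; apply: near_eq_is_derive (df x Ux).
  near=> y; apply: fg; near: y; exact: open_nbhs_nbhs.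
Unshelve. all: by end_near.
Qed.

Lemma rational_continuous U phi : open U -> rational_on U phi ->
  forall x, U x -> {for x, continuous phi}.
Proof.
move=> oU; elim=> [c|i|f g _ cf _ cg|f g _ cf _ cg |f f0 _ cf|f g fg _ cf] x Ux.
- exact: cst_continuous.
- exact: (@coord_continuous R 1 n 0 i x).
- exact: (cvgD (cf x Ux) (cg x Ux)).
- exact: (cvgM (cf x Ux) (cg x Ux)).
- exact: (cvgV (f0 x Ux) (cf x Ux)).
- have fcx : f y @[y --> x] --> g x by rewrite -(fg x Ux); exact: cf.
  apply: (cvg_trans _ fcx); apply: (@near_eq_cvg _ _ (nbhs x)).
  by near=> y; apply: fg; near: y; exact: open_nbhs_nbhs.
Unshelve. all: by end_near.
Qed.

Lemma rational_open U phi : open U -> rational_on U phi ->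
  open [set x | U x /\ phi x != 0].
Proof.
move=> oU rphi; rewrite openE => x [Ux px].
have /cvgr_neq0/(_ px) := rational_continuous oU rphi Ux.
apply: filter_app; near=> y => py; split=> //.
by near: y; exact: open_nbhs_nbhs.
Unshelve. all: by end_near.
Qed.

End Rational.

Lemma rational_comp (R : realType) m n (U : set 'rV[R]_n) (V : set 'rV[R]_m)
    (u : 'rV[R]_n -> 'rV[R]_m) (phi : 'rV[R]_m -> R) :
  (forall x, U x -> V (u x)) -> (forall j, rational_on U (fun x => u x 0 j)) ->
  rational_on V phi -> rational_on U (fun x => phi (u x)).
Proof.
move=> UV ru; elim=> [c|i|f g _ rf _ rg|f g _ rf _ rg|f f0 _ rf|f g fg _ rf] //.
- exact: rational_cst.
- exact: rational_add.
- exact: rational_mul.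
- by apply: rational_inv => // x Ux; apply/f0/UV.
- by apply: rational_ext rf => x Ux; apply/fg/UV.
Qed.

Lemma rational_mx_continuous (R : realType) n m (U : set 'rV[R]_n)
    (f : 'rV[R]_n -> 'rV[R]_m) :
  open U -> (forall j, rational_on U (fun x => f x 0 j)) ->
  forall x, U x -> {for x, continuous f}.
Proof.
move=> oU rf x Ux; suff : f y @[y --> x] --> f x by [].
apply/(@cvgrPdist_le _ _ _ (nbhs x)) => /= e e0.
have fe : \forall y \near x, forall i : 'I_m, `|f x 0 i - f y 0 i| <= e.
  apply: (@filter_forall _ _ (fun i y => `|f x 0 i - f y 0 i| <= e) (nbhs x)) => i.
  have := rational_continuous oU (rf i) Ux; rewrite /prop_for => fci.
  have : f y 0 i @[y --> x] --> f x 0 i by exact: fci.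
  by move/cvgrPdist_le => /(_ _ e0).
near=> y.
rewrite /Num.Def.normr/= mx_normrE (bigmax_le _ (ltW e0))//= => i _.
by rewrite !mxE (ord1 i.1); move: i.2; near: y.
Unshelve. all: by end_near.
Qed.

(** Partial derivatives of a rational map are again rational, so each order of differentiability
    reduces to continuity of rational maps. *)
Lemma rational_smooth (R : realType) n m (U : set 'rV[R]_n)
    (f : 'rV[R]_n -> 'rV[R]_m) :
  open U -> (forall j, rational_on U (fun x => f x 0 j)) -> smooth_on U f.
Proof.
move=> oU rf k; elim: k f rf => [|k IHk] f rf;
  (split; first exact: rational_mx_continuous).
  by [].
move=> j.
have dcoord i := rational_is_derive j oU (rf i).
have df x : U x -> derivable f x (delta_mx 0 j).
  move=> Ux; apply/derivable_mxP => a i; rewrite (ord1 a).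
  by have [psi _ /(_ x Ux)[]] := dcoord i.
split=> //; apply: IHk => i.
have [psi rpsi dpsi] := dcoord i.
apply: rational_ext rpsi => x Ux.
rewrite (derive_mx (df x Ux)) mxE.
by have [_ <-] := dpsi x Ux.
Qed.

Lemma rational_sub (R : realType) n (U V : set 'rV[R]_n) (phi : 'rV[R]_n -> R) :
  U `<=` V -> rational_on V phi -> rational_on U phi.
Proof.
by move=> UV; apply: rational_comp => // j; apply: rational_coord.
Qed.

(** * Matrices with rational entries *)

Section RationalMatrix.
Variables (R : realType) (n : nat) (U : set 'rV[R]_n).

Definition rational_mx_on a b (M : 'rV[R]_n -> 'M[R]_(a, b)) :=
  forall i j, rational_on U (fun x => M x i j).

Lemma rational_mx_sub (U' : set 'rV[R]_n) a b (M : 'rV[R]_n -> 'M[R]_(a, b)) :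
  U `<=` U' -> (forall i j, rational_on U' (fun x => M x i j)) -> rational_mx_on M.
Proof. by move=> UU' rM i j; apply: rational_sub (rM i j). Qed.

Lemma rational_mx_id : rational_mx_on (id : 'rV[R]_n -> 'rV[R]_n).
Proof. by move=> i j; rewrite (ord1 i); apply: rational_coord. Qed.

Lemma rational_mx_cst a b (C : 'M[R]_(a, b)) : rational_mx_on (fun=> C).
Proof. by move=> i j; apply: rational_cst. Qed.

Lemma rational_mxD a b (M N : 'rV[R]_n -> 'M[R]_(a, b)) :
  rational_mx_on M -> rational_mx_on N -> rational_mx_on (fun x => M x + N x).
Proof.
move=> rM rN i j; apply: rational_ext (rational_add (rM i j) (rN i j)) => x _.
by rewrite mxE.
Qed.

Lemma rational_mxB a b (M N : 'rV[R]_n -> 'M[R]_(a, b)) :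
  rational_mx_on M -> rational_mx_on N -> rational_mx_on (fun x => M x - N x).
Proof.
move=> rM rN i j.
have rNij := rational_mul (rational_cst U (-1)) (rN i j).
apply: rational_ext (rational_add (rM i j) rNij) => x _.
by rewrite !mxE mulN1r.
Qed.

Lemma rational_mxM a b c (M : 'rV[R]_n -> 'M[R]_(a, b))
    (N : 'rV[R]_n -> 'M[R]_(b, c)) :
  rational_mx_on M -> rational_mx_on N -> rational_mx_on (fun x => M x *m N x).
Proof.
move=> rM rN i j.
apply: (@rational_ext _ _ _ (fun x => \sum_k M x i k * N x k j)) => [x _|].
  by rewrite mxE.
by apply: rational_sum => k; apply: rational_mul.
Qed.

Lemma rational_mx_det a (M : 'rV[R]_n -> 'M[R]_a) :
  rational_mx_on M -> rational_on U (fun x => \det (M x)).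
Proof.
move=> rM; apply: rational_sum => s; apply: rational_mul; first exact: rational_cst.
by apply: rational_prod => i; apply: rM.
Qed.

(** Cramer's formula: the entries of the inverse are cofactors divided by the determinant. *)
Lemma rational_mx_inv a (M : 'rV[R]_n -> 'M[R]_a) :
  (forall x, U x -> M x \in unitmx) -> rational_mx_on M ->
  rational_mx_on (fun x => invmx (M x)).
Proof.
move=> uM rM i j.
apply: (@rational_ext _ _ _
  (fun x => (\det (M x))^-1 * cofactor (M x) j i)) => [x Ux|].
  by rewrite /invmx uM // !mxE.
apply: rational_mul.
  apply: rational_inv; last exact: rational_mx_det.
  by move=> x /uM; rewrite unitmxE unitfE.
apply: rational_mul; first exact: rational_cst.
apply: rational_mx_det => k l.
by apply: rational_ext (rM (lift j k) (lift i l)) => x _; rewrite !mxE.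
Qed.

End RationalMatrix.

Lemma coord_subspaceE (R : realType) n k (y : 'rV[R]_n) :
  coord_subspace k y <-> y *m copid_mx k = 0.
Proof.
have pidE j : (y *m pid_mx k : 'rV_n) 0 j = if (j < k)%N then y 0 j else 0.
  rewrite mxE (bigD1 j) //= big1 ?addr0 => [|i ij].
    by rewrite mxE eqxx /=; case: ifP; rewrite ?mulr1 ?mulr0.
  by rewrite mxE val_eqE (negPf ij) mulr0.
rewrite mulmxBr mulmx1; split=> [yk|/eqP].
  apply/eqP; rewrite subr_eq0; apply/eqP/rowP => j; rewrite pidE.
  by case: ltnP => // /yk.
by rewrite subr_eq0 => /eqP yk j jk; rewrite yk pidE ltnNge jk.
Qed.

(** * The slice chart *)

Section Chart.
Variables (R : realType) (m n : nat) (S : set 'rV[R]_n) (theta0 : 'rV[R]_n).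
(* The solutions h of [h *m T theta = 0] with [q h != 0] are the isomorphisms
   from theta0 to theta, and [w0] is the identity of theta0. *)
Variables (w0 : 'rV[R]_m) (T : 'rV[R]_n -> 'M[R]_(m, n)) (A : 'M[R]_(m, n)).
Variables (B : 'rV[R]_m -> 'M[R]_n) (q : 'rV[R]_m -> R).
Hypothesis rational_T : rational_mx_on setT T.
Hypothesis rational_B : rational_mx_on setT B.
Hypothesis rational_q : rational_on setT q.
Hypothesis TE : forall h theta, h *m T theta = h *m A - theta *m B h.
Hypothesis B_unit : forall h, q h != 0 -> B h \in unitmx.
Hypothesis w0T : w0 *m T theta0 = 0.
Hypothesis q_w0 : q w0 != 0.
Hypothesis S_sol : forall h theta, q h != 0 -> h *m T theta = 0 -> S theta.
Hypothesis S_rank : forall theta, S theta -> \rank (T theta) = \rank (T theta0).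

Let r : nat := \rank (T theta0).
Let P := col_ebase (T theta0).
Let Q := row_ebase (T theta0).
(** Generalized inverse read off from the factorization [P *m pid_mx r *m Q] of [T theta0]. *)
Let N : 'M[R]_(n, m) := invmx Q *m pid_mx r *m invmx P.
(** When [J theta] is invertible, [h *m J theta = w0] amounts to [h *m T theta *m N = 0] together
    with [h - w0 = h *m (T theta0 *m N)]; [sol theta] is its solution. *)
Let J theta : 'M[R]_m := 1%:M + (T theta - T theta0) *m N.
Let sol theta : 'rV[R]_m := w0 *m invmx (J theta).
(** The first [r] coordinates record [sol theta - w0], the other [n - r] the residual
    [sol theta *m T theta], which [N] kills. *)
Let chart theta : 'rV[R]_n :=
  (sol theta - w0) *m P *m pid_mx r + sol theta *m T theta *m invmx Q.
Let sol' (y : 'rV[R]_n) : 'rV[R]_m := w0 + y *m pid_mx r *m invmx P.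
(** Once [h] and the residual are read off from [y], the identity [TE] is solved for [theta] by
    inverting [B h]. *)
Let chart' (y : 'rV[R]_n) : 'rV[R]_n :=
  (sol' y *m A - y *m copid_mx r *m Q) *m invmx (B (sol' y)).
Let dom : set 'rV[R]_n := [set theta | J theta \in unitmx /\ q (sol theta) != 0].
Let cod : set 'rV[R]_n := [set y | q (sol' y) != 0 /\ J (chart' y) \in unitmx].

Let P_unit : P \in unitmx. Proof. exact: col_ebase_unit. Qed.
Let Q_unit : Q \in unitmx. Proof. exact: row_ebase_unit. Qed.
Let T0E : T theta0 = P *m pid_mx r *m Q. Proof. by rewrite mulmx_ebase. Qed.
Let r_m : (r <= m)%N. Proof. exact: rank_leq_row. Qed.
Let r_n : (r <= n)%N. Proof. exact: rank_leq_col. Qed.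

Let T0N : T theta0 *m N = P *m pid_mx r *m invmx P.
Proof. by rewrite T0E /N !mulmxA mulmxK // -(mulmxA P _ (pid_mx r)) pid_mx_id. Qed.

Let NT0N : N *m (T theta0 *m N) = N.
Proof.
by rewrite T0N /N !mulmxA mulmxKV // -(mulmxA (invmx Q) _ (pid_mx r)) pid_mx_id.
Qed.

Let J_T0N theta : J theta *m (T theta0 *m N) = T theta *m N.
Proof. by rewrite mulmxDl mul1mx -mulmxA NT0N mulmxBl addrC subrK. Qed.

Let w0T0N : w0 *m (T theta0 *m N) = 0. Proof. by rewrite mulmxA w0T mul0mx. Qed.

Let sol_TN theta : J theta \in unitmx -> sol theta *m T theta *m N = 0.
Proof. by move=> uJ; rewrite -mulmxA -J_T0N mulmxA mulmxKV. Qed.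

Let sol_subw0 theta : J theta \in unitmx ->
  sol theta - w0 = sol theta *m (T theta0 *m N).
Proof.
move=> uJ; have : sol theta *m J theta = w0 by rewrite mulmxKV.
rewrite mulmxDr mulmx1 mulmxBl mulmxBr mulmxA sol_TN // sub0r => e.
by rewrite -e subKr.
Qed.

(* [J theta] carries [T theta0 *m N] to [T theta *m N], so [T theta] and
   [T theta *m N] have the same rank, hence the same kernel. *)
Let T_kernel_N theta (h : 'rV[R]_m) : J theta \in unitmx -> \rank (T theta) = r ->
  h *m T theta *m N = 0 -> h *m T theta = 0.
Proof.
move=> uJ rT hTN.
have rTN : \rank (T theta *m N) = r.
  rewrite -J_T0N T0N -mxrank_tr trmx_mul mxrankMfree ?row_free_unit ?unitmx_tr //.
  rewrite mxrank_tr mxrankMfree ?row_free_unit ?unitmx_inv // -mxrank_tr trmx_mul.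
  by rewrite mxrankMfree ?row_free_unit ?unitmx_tr // mxrank_tr rank_pid_mx.
have kTN : (kermx (T theta) <= kermx (T theta *m N))%MS.
  by apply/sub_kermxP; rewrite mulmxA mulmx_ker mul0mx.
apply/sub_kermxP; have [_] := mxrank_leqif_sup kTN.
rewrite !mxrank_ker rTN rT eqxx => /esym; apply: submx_trans.
by apply/sub_kermxP; rewrite mulmxA.
Qed.

Let chart_pid theta : J theta \in unitmx ->
  chart theta *m pid_mx r *m invmx P = sol theta - w0.
Proof.
move=> uJ; rewrite /chart !(mulmxDl (_ *m pid_mx r)).
rewrite -2!(mulmxA (sol theta *m T theta)) -/N.
rewrite sol_TN // addr0 -(mulmxA _ (pid_mx r) (pid_mx r)) pid_mx_id //.
rewrite -(mulmxA _ P) -(mulmxA _ (P *m _)) -T0N sol_subw0 //.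
by rewrite -mulmxA -(mulmxA (T theta0)) NT0N.
Qed.

Let chart_copid theta : J theta \in unitmx ->
  chart theta *m copid_mx r *m Q = sol theta *m T theta.
Proof.
move=> uJ; rewrite /chart mulmxDl -(mulmxA _ (pid_mx r)) mul_pid_mx_copid //.
rewrite mulmx0 add0r mulmxBr mulmx1 mulmxBl mulmxKV //.
(* Factoring the projection through [invmx P] makes [N] appear, so that [sol_TN] applies. *)
have -> : pid_mx r = (pid_mx r : 'M[R]_(n, m)) *m invmx P *m P *m pid_mx r :> 'M[R]_n.
  by rewrite mulmxKV // pid_mx_id.
rewrite !mulmxA -(mulmxA _ (invmx Q)) -(mulmxA _ _ (invmx P)) sol_TN //.
by rewrite !mul0mx subr0.
Qed.

Let sol'_chart theta : J theta \in unitmx -> sol' (chart theta) = sol theta.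
Proof. by move=> uJ; rewrite /sol' chart_pid // addrC subrK. Qed.

Let chartK theta : dom theta -> chart' (chart theta) = theta.
Proof.
move=> [uJ q0]; rewrite /chart' sol'_chart // chart_copid //.
by rewrite TE opprB addrC subrK mulmxK // B_unit.
Qed.

Let chart'_T y : q (sol' y) != 0 -> sol' y *m T (chart' y) = y *m copid_mx r *m Q.
Proof. by move=> qy; rewrite TE mulmxKV ?B_unit // opprB addrC subrK. Qed.

Let sol'_T0N y : sol' y *m (T theta0 *m N) = sol' y - w0.
Proof.
rewrite mulmxDl w0T0N add0r [sol' y]addrC addrK T0N !mulmxA mulmxKV //.
by rewrite -(mulmxA y) pid_mx_id.
Qed.

(** This is the equation defining [sol] at [chart' y], so [sol' y] is recovered wherever [J] is
    invertible. *)
Let sol'_J y : q (sol' y) != 0 -> sol' y *m J (chart' y) = w0.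
Proof.
move=> qy; rewrite mulmxDr mulmx1 mulmxBl mulmxBr sol'_T0N mulmxA chart'_T //.
rewrite /N !mulmxA mulmxK // -(mulmxA y) mul_copid_mx_pid // mulmx0 mul0mx.
by rewrite sub0r subKr.
Qed.

Let chart'_sol y : cod y -> sol (chart' y) = sol' y.
Proof. by move=> [qy uJ]; rewrite /sol -[in LHS](sol'_J qy) mulmxK. Qed.

Let chart'K y : cod y -> chart (chart' y) = y.
Proof.
move=> Cy; have [qy uJ] := Cy.
rewrite /chart chart'_sol // chart'_T // mulmxK // [sol' y]addrC addrK.
rewrite mulmxKV // -mulmxA pid_mx_id // mulmxBr mulmx1.
by rewrite addrC subrK.
Qed.

Let dom_chart theta : dom theta -> cod (chart theta).
Proof.
move=> Dt; have [uJ qt] := Dt.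
by rewrite /cod /= sol'_chart // chartK.
Qed.

Let cod_chart' y : cod y -> dom (chart' y).
Proof. by move=> Cy; have [qy uJ] := Cy; split; rewrite ?chart'_sol. Qed.

Let dom_S theta : dom theta -> S theta <-> coord_subspace r (chart theta).
Proof.
move=> [uJ qt]; rewrite coord_subspaceE; split=> [/S_rank rT|e].
  have solT : sol theta *m T theta = 0 by apply: T_kernel_N; rewrite ?sol_TN.
  by rewrite -[LHS](mulmxK Q_unit) chart_copid // solT mul0mx.
by apply: (S_sol qt); rewrite -chart_copid // e mul0mx.
Qed.

Let rational_J (U : set 'rV[R]_n) : rational_mx_on U J.
Proof.
apply: rational_mxD; first exact: rational_mx_cst.
apply: rational_mxM; last exact: rational_mx_cst.
apply: rational_mxB; last exact: rational_mx_cst.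
exact: rational_mx_sub rational_T.
Qed.

(** Openness of [dom] takes two stages: [sol] is shown rational where [J] is invertible, and then
    [q (sol theta) != 0] is an open condition there. The set [cod0] does the same for [cod]. *)
Let dom0 : set 'rV[R]_n := [set theta | J theta \in unitmx].

Let dom0_open : open dom0.
Proof.
have := rational_open openT (rational_mx_det (rational_J setT)).
congr open; apply/seteqP; split=> x /=; rewrite /dom0 /= unitmxE unitfE.
  by case.
by [].
Qed.

Let rational_sol : rational_mx_on dom0 sol.
Proof.
apply: rational_mxM; first exact: rational_mx_cst.
exact: rational_mx_inv.
Qed.

Let dom_open : open dom.
Proof.
apply: (rational_open dom0_open).
by apply: (rational_comp _ (rational_sol 0) rational_q).
Qed.

Let rational_chart : rational_mx_on dom chart.
Proof.
have rs : rational_mx_on dom sol by apply: rational_mx_sub rational_sol => x [].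
apply: rational_mxD.
  apply: rational_mxM; last exact: rational_mx_cst.
  apply: rational_mxM; last exact: rational_mx_cst.
  by apply: rational_mxB => //; exact: rational_mx_cst.
apply: rational_mxM; last exact: rational_mx_cst.
by apply: rational_mxM => //; apply: rational_mx_sub rational_T.
Qed.

Let rational_sol' (V : set 'rV[R]_n) : rational_mx_on V sol'.
Proof.
apply: rational_mxD; first exact: rational_mx_cst.
apply: rational_mxM; last exact: rational_mx_cst.
by apply: rational_mxM; [exact: rational_mx_id|exact: rational_mx_cst].
Qed.

Let cod0 : set 'rV[R]_n := [set y | q (sol' y) != 0].

Let cod0_open : open cod0.
Proof.
have rq : rational_on setT (q \o sol').
  by apply: (rational_comp _ (rational_sol' setT 0) rational_q).
have := rational_open openT rq.
by congr open; apply/seteqP; split=> x //= [].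
Qed.

Let rational_chart' : rational_mx_on cod0 chart'.
Proof.
apply: rational_mxM.
  apply: rational_mxB.
    by apply: rational_mxM; [exact: rational_sol'|exact: rational_mx_cst].
  apply: rational_mxM; last exact: rational_mx_cst.
  by apply: rational_mxM; [exact: rational_mx_id|exact: rational_mx_cst].
apply: rational_mx_inv => [y qy|i j]; first exact: B_unit.
by apply: (rational_comp _ (rational_sol' cod0 0) (rational_B i j)).
Qed.

Let cod_open : open cod.
Proof.
have rd : rational_on cod0 (fun y => \det (J (chart' y))).
  apply: (@rational_comp _ _ _ _ setT chart' (fun x => \det (J x))) => [//|j|].
    exact: rational_chart'.
  exact: rational_mx_det.
have := rational_open cod0_open rd.
by congr open; apply/seteqP; split=> x [qx] /=; rewrite /cod /= unitmxE unitfE.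
Qed.

Lemma slice_chart : exists (U V : set 'rV[R]_n) (f : 'rV[R]_n -> 'rV[R]_n),
  [/\ U theta0, smooth_diffeo U V f & f @` (S `&` U) = coord_subspace r `&` V].
Proof.
exists dom, cod, chart; split.
- have J0 : J theta0 = 1%:M by rewrite /J subrr mul0mx addr0.
  by split; rewrite ?J0 ?unitmx1 // /sol J0 invmx1 mulmx1.
- split=> //.
  + apply/seteqP; split=> [_ [x Dx <-]|y Cy]; first exact: dom_chart.
    by exists (chart' y); [exact: cod_chart'|exact: chart'K].
  + by apply: rational_smooth => // j; apply: rational_chart.
  exists chart'; last exact: chartK.
  apply: rational_smooth => // j.
  by apply: rational_sub (rational_chart' 0 j) => y [].
apply/seteqP; split=> [_ [x [Sx Dx] <-]|y [ky Cy]].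
  by split; [exact/dom_S|exact: dom_chart].
exists (chart' y); last exact: chart'K.
by split; [apply/dom_S; rewrite ?chart'K //|]; exact: cod_chart'.
Qed.

End Chart.

(** * Strata *)

(** Lets a plain function with a proof of linearity be represented by its matrix. *)
Lemma mul_rV_linear (R : pzRingType) m n (f : 'rV[R]_m -> 'rV[R]_n) u :
  linear f -> u *m lin1_mx f = f u.
Proof.
move=> lf; pose fM := GRing.isLinear.Build R 'rV[R]_m 'rV[R]_n _ f lf.
pose fL : {linear 'rV[R]_m -> 'rV[R]_n} := HB.pack f fM.
exact: (mul_rV_lin1 fL).
Qed.

Lemma rational_lin1_mx (R : realType) n (U : set 'rV[R]_n) a b
    (f : 'rV[R]_n -> 'rV[R]_a -> 'rV[R]_b) :
  (forall u, rational_mx_on U (fun x => f x u)) ->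
  rational_mx_on U (fun x => lin1_mx (f x)).
Proof.
move=> rf i j; apply: rational_ext (rf (delta_mx 0 i) 0 j) => x _.
by rewrite mxE.
Qed.

(** * Families of matrices as row vectors *)

Section Blocks.
Variables (R : realType) (K : nat) (a b : nat -> nat).

(** Follows the encoding of [layer] with arbitrary block sizes, so that [layer] is an instance by
    conversion and families of square matrices are covered too. *)
Definition block (x : 'rV[R]_(\sum_(j < K) a j * b j)%N) (j : nat) :
     'M[R]_(a j, b j) :=
  if pselect (j < K)%N is left j_lt_K
  then vec_mx (submxrow x (Ordinal j_lt_K)) else 0.

Definition pack (B : forall j, 'M[R]_(a j, b j)) :
     'rV[R]_(\sum_(j < K) a j * b j)%N :=
  \mxrow_(j < K) mxvec (B j).

Lemma packK B j : (j < K)%N -> block (pack B) j = B j.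
Proof.
by move=> jK; rewrite /block; case: pselect => // j_lt_K; rewrite mxrowK mxvecK.
Qed.

Lemma block_inj x y : (forall j, (j < K)%N -> block x j = block y j) -> x = y.
Proof.
move=> xy; apply/mxrowP => -[j jK]; have := xy j jK.
rewrite /block; case: pselect => // j_lt_K /(can_inj vec_mxK).
by rewrite (bool_irrelevance j_lt_K jK).
Qed.

Lemma block_linear j : linear (block^~ j).
Proof.
move=> c x y; rewrite /block; case: pselect => [j_lt_K|_].
  by rewrite -linearP; congr vec_mx; apply/matrixP => i k; rewrite !mxE.
by rewrite scaler0 addr0.
Qed.

Lemma block0 j : block 0 j = 0.
Proof. by have := block_linear j (-1) 0 0; rewrite /= !scaleN1r !addNr. Qed.

Lemma pack_linear c B C :
  pack (fun j => c *: B j + C j) = c *: pack B + pack C.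
Proof. by apply: block_inj => j jK; rewrite block_linear !packK. Qed.

Lemma eq_pack B C : (forall j, (j < K)%N -> B j = C j) -> pack B = pack C.
Proof. by move=> BC; apply: block_inj => j jK; rewrite !packK ?BC. Qed.

Variables (n : nat) (U : set 'rV[R]_n).

Lemma rational_block x j : rational_mx_on U x ->
  rational_mx_on U (fun t => block (x t) j).
Proof.
move=> rx i k; rewrite /block.
case: pselect => [j_lt_K|_]; last exact: rational_mx_cst.
by apply: rational_ext (rx 0 _) => t _; rewrite !mxE.
Qed.

Lemma rational_pack (B : 'rV[R]_n -> forall j, 'M[R]_(a j, b j)) :
  (forall j, (j < K)%N -> rational_mx_on U (fun t => B t j)) ->
  rational_mx_on U (fun t => pack (B t)).
Proof.
move=> rB i k; rewrite (ord1 i).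
apply: (@rational_ext _ _ _
  (fun t => mxvec (B t (tagnat.sig1 k)) 0 (tagnat.sig2 k))).
  by move=> t _; rewrite [RHS]mxE.
case/mxvec_indexP: (tagnat.sig2 k) => r s.
by apply: rational_ext (rB _ (ltn_ord _) r s) => t _; rewrite mxvecE.
Qed.

End Blocks.

Section ChainMorphism.
Variables (R : realType) (e : nat -> nat) (A A' : forall j, 'M[R]_(e j.+1, e j)).
Variables (n : nat) (g : forall j, 'M[R]_(e j)).
Hypothesis gA : forall j, (j < n)%N -> g j.+1 *m A j = A' j *m g j.

Lemma chain_prod_morph k : (k <= n)%N ->
  g k *m chain_prod A k = chain_prod A' k *m g 0%N.
Proof.
elim: k => [|k IHk] kn /=; first by rewrite mulmx1 mul1mx.
by rewrite mulmxA gA // -mulmxA IHk 1?ltnW // mulmxA.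
Qed.

Lemma rank_chain_prod_morph k : (k <= n)%N -> g k \in unitmx -> g 0%N \in unitmx ->
  \rank (chain_prod A k) = \rank (chain_prod A' k).
Proof.
move=> kn uk u0.
rewrite -[RHS](mxrankMfree _ (_ : row_free (g 0%N))) ?row_free_unit //.
rewrite -chain_prod_morph // -[RHS]mxrank_tr trmx_mul.
by rewrite mxrankMfree ?row_free_unit ?unitmx_tr // mxrank_tr.
Qed.

End ChainMorphism.

(** * The morphism equations between points of a stratum *)

Section Fiber.
Variables (R : realType) (L : nat) (d : nat -> nat) (W : 'M[R]_(d L, d 0%N)).
Variable r : nat -> nat -> nat.

Let theta_dim := dtheta L d.
Let S : set 'rV[R]_theta_dim := stratum W r.
Let Theta := 'rV[R]_theta_dim.

Let packL := @pack R L (fun j => d j.+1) d.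

Let layerE (theta : Theta) j :
  layer theta j = block (a := fun j => d j.+1) (b := d) (K := L) theta j.
Proof. by []. Qed.

Let p := (\sum_(j < L.+1) d j * d j)%N.
Let defect (x : 'rV[R]_p) : 'rV[R]_(d L * d 0%N) :=
  mxvec (block (a := d) (b := d) x L *m W - W *m block (a := d) (b := d) x 0).

Let defect_linear : linear defect.
Proof.
move=> c x y; rewrite /defect !block_linear -linearP; congr mxvec.
by rewrite mulmxDl mulmxDr -scalemxAl -scalemxAr scalerBr opprD addrACA.
Qed.

(* [coef h] runs over the families F with F_L W = W F_0; h is not unique. *)
Let coef (h : 'rV[R]_p) (j : nat) : 'M[R]_(d j) :=
  block (a := d) (b := d) (h *m kermx (lin1_mx defect)) j.

Let coefW h : coef h L *m W = W *m coef h 0.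
Proof.
apply/eqP; rewrite -subr_eq0; apply/eqP; apply: (can_inj mxvecK).
rewrite linear0 -/(defect _) -mul_rV_linear //.
by rewrite -mulmxA mulmx_ker mulmx0.
Qed.

Let exists_coef (g : forall j, 'M[R]_(d j)) : g L *m W = W *m g 0%N ->
  exists h, forall j, (j <= L)%N -> coef h j = g j.
Proof.
move=> gW; have : (pack L.+1 g <= kermx (lin1_mx defect))%MS.
  by apply/sub_kermxP; rewrite mul_rV_linear // /defect !packK // gW subrr linear0.
by case/submxP => h hE; exists h => j jL; rewrite /coef -hE packK.
Qed.

Let coef_linear j : linear (coef^~ j).
Proof. by move=> c x y; rewrite /coef mulmxDl -scalemxAl block_linear. Qed.

Let target (theta0 : Theta) h : Theta :=
  packL (fun j => coef h j.+1 *m layer theta0 j).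
Let act h (theta : Theta) : Theta := packL (fun j => layer theta j *m coef h j).
Let T theta0 theta := lin1_mx (fun h => target theta0 h - act h theta).

Let target_linear theta0 : linear (target theta0).
Proof.
move=> c x y; rewrite /target -pack_linear; apply: eq_pack => j _.
by rewrite coef_linear mulmxDl scalemxAl.
Qed.

Let act_linear h : linear (act h).
Proof.
move=> c x y; rewrite /act -pack_linear; apply: eq_pack => j _.
by rewrite !layerE block_linear mulmxDl scalemxAl.
Qed.

Let act_linear_l theta : linear (act^~ theta).
Proof.
move=> c x y; rewrite /act -pack_linear; apply: eq_pack => j _.
by rewrite coef_linear mulmxDr scalemxAr.
Qed.

Let TE theta0 theta h : h *m T theta0 theta = target theta0 h - act h theta.
Proof.
rewrite mul_rV_linear // => c x y.
by rewrite target_linear act_linear_l opprD addrACA scalerBr.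
Qed.

Let layer_T theta0 theta h j : (j < L)%N -> layer (h *m T theta0 theta) j =
  coef h j.+1 *m layer theta0 j - layer theta j *m coef h j.
Proof.
move=> jL; rewrite TE /target /act addrC -scaleN1r -pack_linear layerE packK //.
by rewrite scaleN1r addrC.
Qed.

(** Both chains multiply to the same [W], so an isomorphism between them satisfies the constraint at
    the two ends. *)
Let stratum_iso theta theta' : S theta -> S theta' ->
  exists g : forall j, 'M[R]_(d j), [/\ forall j, (j <= L)%N -> g j \in unitmx,
    forall j, (j < L)%N -> g j.+1 *m layer theta j = layer theta' j *m g j &
    g L *m W = W *m g 0%N].
Proof.
move=> [muW rk] [muW' rk'].
have [k i kL|g ug gA] := @chain_iso R d (layer theta) (layer theta') L.
  by rewrite -/(subproduct _ _ _) -/(subproduct theta' _ _) rk ?rk'.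
exists g; split=> //.
by have := chain_prod_morph gA (leqnn L); rewrite -!/(mu _) muW muW'.
Qed.

(** With isomorphisms g from [theta2] to [theta1] and k from [theta02] to [theta01], the change of
    variable F' = g^-1 F k turns [T theta01 theta1] into [T theta02 theta2] followed by the linear
    map [tr]. *)
Let rank_T_le theta1 theta2 theta01 theta02 :
  S theta1 -> S theta2 -> S theta01 -> S theta02 ->
  (\rank (T theta01 theta1) <= \rank (T theta02 theta2))%N.
Proof.
move=> S1 S2 S01 S02.
have [g [ug gA gW]] := stratum_iso S2 S1.
have [k [uk kA kW]] := stratum_iso S02 S01.
pose tr (z : Theta) : Theta := packL (fun j => g j.+1 *m layer z j *m invmx (k j)).
have tr_linear : linear tr.
  move=> c x y; rewrite /tr -pack_linear; apply: eq_pack => j _.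
  by rewrite !layerE block_linear mulmxDr mulmxDl -scalemxAr -scalemxAl.
apply: leq_trans (mxrankM_maxl _ (lin1_mx tr)); apply: mxrankS.
apply/row_subP => i; rewrite rowE; set h := delta_mx 0 i.
(* This family satisfies the constraint at the two ends because g, k and [coef h] all do. *)
have [|h' h'E] := @exists_coef (fun j => invmx (g j) *m coef h j *m k j).
  rewrite /= -(mulmxA _ (k L)) kW !mulmxA; congr (_ *m _).
  rewrite -(mulmxA _ _ W) coefW mulmxA.
  congr (_ *m _); apply: (canRL (mulmxK (ug _ _))) => //.
  by rewrite -mulmxA -gW mulKmx // ug.
have -> : h *m T theta01 theta1 = h' *m T theta02 theta2 *m lin1_mx tr.
  rewrite (mul_rV_linear _ tr_linear).
  apply: (@block_inj R L (fun j => d j.+1) d) => j jL.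
  rewrite -!layerE [RHS]packK // !layer_T // !h'E // 1?ltnW //.
  have uj : g j.+1 \in unitmx by apply: ug.
  have ukj : k j \in unitmx by rewrite uk // ltnW.
  have ugj : g j \in unitmx by rewrite ug // ltnW.
  rewrite mulmxBr mulmxBl !mulmxA mulmxV // mul1mx mulmxK // gA // mulmxK //.
  by rewrite -!mulmxA (mulmxA (k j.+1)) kA // mulmxK.
by rewrite -mulmxA submxMl.
Qed.

Let rank_T theta1 theta2 theta01 theta02 :
  S theta1 -> S theta2 -> S theta01 -> S theta02 ->
  \rank (T theta01 theta1) = \rank (T theta02 theta2).
Proof. by move=> *; apply/eqP; rewrite eqn_leq !rank_T_le. Qed.

(** One polynomial whose nonvanishing says that every F_j is invertible. *)
Let q h := \prod_(j < L.+1) \det (coef h j).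

Let q_unit h j : q h != 0 -> (j <= L)%N -> coef h j \in unitmx.
Proof.
move=> qh jL; rewrite unitmxE unitfE.
by move/prodf_neq0: qh => /(_ (Ordinal (jL : (j < L.+1)%N)) isT).
Qed.

Let act_unit h : q h != 0 -> lin1_mx (act h) \in unitmx.
Proof.
move=> qh; rewrite -row_free_unit -kermx_eq0; apply/rowV0P => v /sub_kermxP.
rewrite mul_rV_linear // => v0; apply: (@block_inj R L (fun j => d j.+1) d) => j jL.
have := congr1 (fun x : Theta => layer x j) v0; rewrite /= [LHS]packK //.
have uj : coef h j \in unitmx by rewrite q_unit // ltnW.
by rewrite !layerE !block0 -/(layer v j) => /(canRL (mulmxK uj)) ->; rewrite mul0mx.
Qed.

Let S_sol theta0 h theta : S theta0 -> q h != 0 ->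
  h *m T theta0 theta = 0 -> S theta.
Proof.
move=> [mu0 rk0] qh T0.
have gA j : (j < L)%N -> coef h j.+1 *m layer theta0 j = layer theta j *m coef h j.
  move=> jL; apply/eqP; rewrite -subr_eq0 -layer_T // T0.
  by rewrite layerE block0.
split.
  (* The constraint replaces F_L W by W F_0; cancelling the invertible F_0 leaves [mu theta = W]. *)
  have := chain_prod_morph gA (leqnn L); rewrite -!/(mu _) mu0 coefW => e.
  by apply: (can_inj (mulmxK (q_unit qh (leq0n L)))).
move=> k i /andP[ik kL]; rewrite -rk0 ?ik //; apply/esym.
have kiL j : (j <= k - i)%N -> (j + i <= L)%N.
  by move=> jki; apply: leq_trans kL; rewrite addnC -leq_subRL.
apply: (rank_chain_prod_morph (g := fun j => coef h (j + i)) (n := (k - i)%N)) => //.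
- by move=> j jki; apply: gA; apply: (kiL j.+1).
- by apply: q_unit => //; apply: kiL.
- by apply: q_unit => //; apply: kiL.
Qed.

Let rational_coef n (U : set 'rV[R]_n) x j : rational_mx_on U x ->
  rational_mx_on U (fun t => coef (x t) j).
Proof.
by move=> rx; apply/rational_block/rational_mxM => //; apply: rational_mx_cst.
Qed.

Lemma stratum_smooth_manifold theta0 : S theta0 -> smooth_manifold S.
Proof.
move=> S0; exists (\rank (T theta0 theta0)); split; first exact: rank_leq_col.
(* The chart at [theta] is built from [T theta]; constancy of the rank gives it the slice dimension
   fixed at [theta0]. *)
move=> theta St; rewrite (rank_T S0 St S0 St).
have [|w w1] := @exists_coef (fun j => 1%:M); first by rewrite mul1mx mulmx1.
apply: (@slice_chart R p theta_dim S theta w (T theta) (lin1_mx (target theta))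
          (fun h => lin1_mx (act h)) q).
- apply: rational_lin1_mx => h; apply: rational_mxB; first exact: rational_mx_cst.
  apply: rational_pack => j _; apply: rational_mxM; last exact: rational_mx_cst.
  exact: (@rational_block R L (fun j => d j.+1) d _ setT id j
    (@rational_mx_id _ _ _)).
- apply: rational_lin1_mx => t; apply: rational_pack => j _.
  apply: rational_mxM; first exact: rational_mx_cst.
  exact/rational_coef/rational_mx_id.
- apply: rational_prod => j; apply: rational_mx_det.
  exact/rational_coef/rational_mx_id.
- by move=> h t; rewrite TE !mul_rV_linear.
- exact: act_unit.
- rewrite TE; apply/eqP; rewrite subr_eq0; apply/eqP; apply: eq_pack => j jL.
  by rewrite !w1 /= ?mul1mx ?mulmx1 // ltnW.
- rewrite /q big1 ?oner_eq0 // => j _.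
  by rewrite w1 ?det1 // -ltnS.
- by move=> h t; apply: S_sol.
- by move=> t St'; apply: rank_T.
Qed.

End Fiber.

Theorem theorem16 (R : realType) (L : nat) (d : nat -> nat)
    (L_ge1 : (1 <= L)%N) (d_ge1 : forall j, (j <= L)%N -> (1 <= d j)%N)
    (W : 'M[R]_(d L, d 0%N)) (S : set (weight_space R L d)) :
  rank_stratification W S -> smooth_manifold S.
Proof.
move=> [r -> [theta fW rW]].
exact: (@stratum_smooth_manifold R L d W r theta).
Qed.
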